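(* Let $(X,Y)$ be a productive synchronized pair of finite racks. There exists $N_0$ such that for every $N\ge N_0$ and all $v,w\in S^*_{X\times Y}(N)$ satisfying (i) the projections of $v$ and $w$ to $S_X$ coincide, (ii) the projections of $v$ and $w$ to $S_Y$ coincide, and (iii) for every $t\in X_{\mathrm{triv}}\times Y_{\mathrm{triv}}$ the number of entries of $v$ projecting to $t$ equals the number of entries of $w$ projecting to $t$, we have $v=w$.
   Context: A rack is a set $X$ with an operation $x^y$ such that $x\mapsto x^y$ is bijective for each $y$ and $(z^x)^y=(z^y)^{x^y}$; the product rack has $(x,a)^{(y,b)}=(x^y,a^b)$. Connected components of a rack are the classes of the smallest equivalence relation with $x\sim x^y$; $X_{\mathrm{triv}}$ is the set of components. $\Gamma_X=\langle X\mid y^{-1}xy=x^y\rangle$; $(X,Y)$ is productive if $\Gamma'_{X\times Y}\to\Gamma'_X\times\Gamma'_Y$ (induced on commutator subgroups) is injective, and synchronized if $(X\times Y)_{\mathrm{triv}}\to X_{\mathrm{triv}}\times Y_{\mathrm{triv}}$ is bijective. $B_n$ acts on $Z^n$ ($Z$ a rack) by $(\dots,z_i,z_{i+1},\dots)^{\sigma_i}=(\dots,z_{i+1},z_i^{z_{i+1}},\dots)$; $S_Z=\bigsqcup_{n\ge1}Z^n/B_n$ with concatenation; projections $S_{X\times Y}\to S_X,S_Y$ are induced entrywise. For a finite rack $Z$ with components $C_1,\dots,C_k$, $S^*_Z(N)=\bigcup_{n_1,\dots,n_k\ge N}Z^*(n_1,\dots,n_k)/B_n$, where $Z^*(n_1,\dots,n_k)$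 is the set of tuples with exactly $n_j$ entries in $C_j$ whose entries generate $Z$ (lie in no proper subset closed under the operation). The number of entries of an orbit projecting to a given $t$ is well defined. *)

(* Defs.v *)
From mathcomp Require Import all_boot.
From Stdlib Require Import Relations.
Set Implicit Arguments. Unset Strict Implicit. Unset Printing Implicit Defensive.

(* A rack structure on a (finite) type T: op x y = x^y. *)
Definition is_rack (T : Type) (op : T -> T -> T) : Prop :=
  (forall y, bijective (fun x => op x y)) /\
  (forall x y z, op (op z x) y = op (op z y) (op x y)).

Definition prod_op (X Y : Type) (opX : X -> X -> X) (opY : Y -> Y -> Y)
  (p q : X * Y) : X * Y := (opX p.1 q.1, opY p.2 q.2).

Definition rack_conn (T : finType) (op : T -> T -> T) : rel T :=
  connect [rel a b | [exists y, (b == op a y) || (a == op b y)]].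

(* Synchronized: the induced map (X x Y)_triv -> X_triv x Y_triv,
   [(x,a)] |-> ([x],[a]), is bijective (classes given by representatives). *)
Definition synchronized (X Y : finType) (opX : X -> X -> X) (opY : Y -> Y -> Y)
  : Prop :=
  (forall p q : X * Y, rack_conn opX p.1 q.1 -> rack_conn opY p.2 q.2 ->
       rack_conn (prod_op opX opY) p q) /\
  (forall (x : X) (a : Y), exists p : X * Y,
       rack_conn opX p.1 x /\ rack_conn opY p.2 a).

(* The group Gamma_T = < T | y^-1 x y = x^y >, elements represented by words
   over T (letter (x,false) = x, (x,true) = x^-1); equality in Gamma_T is the
   congruence generated by free cancellation and the defining relations. *)
Definition word (T : Type) := seq (T * bool).

Inductive gamma_eq (T : Type) (op : T -> T -> T) : word T -> word T -> Prop :=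
| gamma_refl s : gamma_eq op s s
| gamma_sym s t : gamma_eq op s t -> gamma_eq op t s
| gamma_trans s t u : gamma_eq op s t -> gamma_eq op t u -> gamma_eq op s u
| gamma_cat s1 s2 t1 t2 : gamma_eq op s1 t1 -> gamma_eq op s2 t2 ->
    gamma_eq op (s1 ++ s2) (t1 ++ t2)
| gamma_free x b : gamma_eq op [:: (x, b); (x, ~~ b)] [::]
| gamma_rel x y : gamma_eq op [:: (y, true); (x, false); (y, false)]
                              [:: (op x y, false)].

Definition word_inv (T : Type) (w : word T) : word T :=
  rev (map (fun p => (p.1, ~~ p.2)) w).

Definition word_comm (T : Type) (a b : word T) : word T :=
  word_inv a ++ word_inv b ++ a ++ b.

Definition in_comm_sub (T : Type) (op : T -> T -> T) (w : word T) : Prop :=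
  exists cs : seq (word T * word T),
    gamma_eq op w (flatten (map (fun c => word_comm c.1 c.2) cs)).

Definition map_word (A B : Type) (f : A -> B) (w : word A) : word B :=
  map (fun p => (f p.1, p.2)) w.

Definition productive (X Y : Type) (opX : X -> X -> X) (opY : Y -> Y -> Y)
  : Prop :=
  forall u v : word (X * Y),
    in_comm_sub (prod_op opX opY) u -> in_comm_sub (prod_op opX opY) v ->
    gamma_eq opX (map_word fst u) (map_word fst v) ->
    gamma_eq opY (map_word snd u) (map_word snd v) ->
    gamma_eq (prod_op opX opY) u v.

Definition hmove (T : Type) (op : T -> T -> T) (s t : seq T) : Prop :=
  exists (a b : seq T) (c d : T), s = a ++ c :: d :: b /\ t = a ++ d :: op c d :: b.

(* Same B_n-orbit (the braid group is generated by the sigma_i, which act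
   bijectively): equivalence closure of Hurwitz moves. Elements of S_T are
   represented by tuples; equality in S_T is braid_equiv. *)
Definition braid_equiv (T : Type) (op : T -> T -> T) : relation (seq T) :=
  clos_refl_sym_trans (seq T) (hmove op).

Definition generates (T : finType) (op : T -> T -> T) (s : seq T) : Prop :=
  forall S : {set T}, (forall a b, a \in S -> b \in S -> op a b \in S) ->
    all (fun e => e \in S) s -> S = setT.

Definition in_Sstar (T : finType) (op : T -> T -> T) (N : nat) (s : seq T)
  : Prop :=
  0 < size s /\
  (forall z : T, N <= count (fun e => rack_conn op e z) s) /\
  generates op s.

(* Main.v *)
From Stdlib Require Import Relations Setoid Morphisms Classical.
Require Import Defs.
From mathcomp Require Import all_boot zify.

(** Write [T] for the rack [X * Y] and [S] for the monoid of its braid orbits,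
    whose group completion is [Gamma_T].

    Synchronization makes condition (iii) say that [v] and [w] have the same
    number of entries in each component of [T], i.e. that [v w^-1] is in the
    commutator subgroup of [Gamma_T]; by (i), (ii) and productivity it is then
    trivial, so [v = w] in [Gamma_T].

    It remains to descend from [Gamma_T] to [S].  With [m = #|T|!], every power
    [z^m] is central in [S], and [u z^m = u z'^m] if [u] generates [T] and [z],
    [z'] are in the same component.  Hence [S] becomes [Gamma_T] after inverting
    one central element [D], the product of all the [z^m]: elements of [S] equal
    in [Gamma_T] become equal after multiplication by some power of [D].
    Splitting off central powers from both sides reduces to finitely many pairs,
    so one exponent [K] serves for all generating words with enough entries in
    each component; and a word with sufficiently many entries in each component
    is itself of the form [u D^K]. *)

Set Implicit Arguments.
Unset Strict Implicit.
Unset Printing Implicit Defensive.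

(** * Uniform bounds over finite families *)

Lemma finType_uniform_bound (T : finType) (P : T -> nat -> Prop) :
  (forall x j k, j <= k -> P x j -> P x k) ->
  (forall x, exists k, P x k) -> exists K, forall x, P x K.
Proof.
move=> Pmono /fin_all_exists[f Pf]; exists (\max_x f x) => x.
exact: Pmono (leq_bigmax x) (Pf x).
Qed.

(** Induction on [B]: the first letter ranges over a finite type, so the bounds for the tails have a
    maximum. *)
Lemma bounded_seq_uniform_bound (T : finType) (B : nat)
    (P : seq T -> nat -> Prop) :
  (forall s j k, j <= k -> P s j -> P s k) ->
  (forall s, exists k, P s k) -> exists K, forall s, size s <= B -> P s K.
Proof.
elim: B P => [|B IHB] P Pmono exP.
  by have [K PK] := exP [::]; exists K; case.
have [K0 PK0] := exP [::].
have [|x|K1 PK1] := @finType_uniform_bound T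
  (fun x k => forall s, size s <= B -> P (x :: s) k).
- by move=> x j k le_jk Pj s /Pj; apply: Pmono.
- by apply: IHB => // s j k; apply: Pmono.
exists (maxn K0 K1) => -[_|x s le_sB].
  exact: Pmono (leq_maxl _ _) PK0.
exact: Pmono (leq_maxr _ _) (PK1 x s le_sB).
Qed.

(** [generates] tests only finite sets, so a property has to be turned into one. *)
Lemma finset_of_Prop (T : finType) (P : T -> Prop) :
  exists S : {set T}, forall x, x \in S <-> P x.
Proof.
have /fin_all_exists[f fP] x : exists b : bool, b <-> P x.
  by case: (classic (P x)) => Px; [exists true | exists false]; split.
by exists [set x | f x] => x; rewrite inE.
Qed.

Lemma count_sum_count_mem (T : finType) (p : pred T) (s : seq T) :
  count p s = \sum_(x | p x) count_mem x s.
Proof.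
elim: s => [|a s IHs] /=; first by rewrite big1.
rewrite big_split /= -IHs; congr (_ + _).
case pa: (p a); last first.
  by rewrite big1 // => x px; case: eqP => // eq_ax; rewrite eq_ax px in pa.
by rewrite (bigD1 a) //= eqxx big1 // => x /andP[_ /negPf]; rewrite eq_sym => ->.
Qed.

(** * Words in [Gamma_T] and its abelianization *)

Definition pos_word (T : Type) (s : seq T) : word T := [seq (x, false) | x <- s].

Lemma map_word_pos (A B : Type) (f : A -> B) s :
  map_word f (pos_word s) = pos_word (map f s).
Proof. by rewrite /map_word /pos_word -!map_comp. Qed.

Lemma map_word_inv (A B : Type) (f : A -> B) w :
  map_word f (word_inv w) = word_inv (map_word f w).
Proof. by rewrite /map_word /word_inv map_rev -!map_comp. Qed.

Lemma word_invK (T : Type) : involutive (@word_inv T).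
Proof.
move=> w; rewrite /word_inv map_rev revK -map_comp -[RHS]map_id.
by apply: eq_map => -[x b] /=; rewrite negbK.
Qed.

Section Gamma.

Variables (T : Type) (op : T -> T -> T).

Notation "s =g t" := (gamma_eq op s t) (at level 70).

#[local] Hint Resolve gamma_refl : core.

#[local] Instance gamma_eq_equivalence : Equivalence (gamma_eq op).
Proof.
split; [exact: gamma_refl | exact: gamma_sym | exact: gamma_trans].
Qed.

#[local] Instance gamma_eq_cat_proper :
  Proper (gamma_eq op ==> gamma_eq op ==> gamma_eq op) (@cat (T * bool)).
Proof. by move=> s1 t1 eq1 s2 t2 eq2; apply: gamma_cat. Qed.

Lemma gamma_mulV w : w ++ word_inv w =g [::].
Proof.
elim: w => [|[x b] w IHw] /=; first exact: gamma_refl.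
rewrite /word_inv /= rev_cons -cats1 -cat1s -/(word_inv w) (catA w) IHw /=.
exact: gamma_free.
Qed.

Lemma gamma_Vmul w : word_inv w ++ w =g [::].
Proof. by have := gamma_mulV (word_inv w); rewrite word_invK. Qed.

Lemma gamma_mulK s t : (s ++ t) ++ word_inv t =g s.
Proof. by rewrite -catA gamma_mulV cats0. Qed.

Lemma gamma_cancel_right s t u : s ++ u =g t ++ u -> s =g t.
Proof. by move=> eq_st; rewrite -(gamma_mulK s u) eq_st gamma_mulK. Qed.

(** A Hurwitz move reads $cd = d(d^{-1}cd) = d\,c^d$. *)
Lemma gamma_of_braid s t :
  braid_equiv op s t -> pos_word s =g pos_word t.
Proof.
elim=> {s t} [_ _ [a [b [c [d [-> ->]]]]] | s | s t _ -> | s t u _ -> _] //.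
rewrite /pos_word !map_cat /= -/(pos_word a) -/(pos_word b).
apply: gamma_cat; first exact: gamma_refl.
rewrite -[_ :: _]/([:: (c, false); (d, false)] ++ pos_word b).
rewrite -[X in _ =g X]/(([:: (d, false)] ++ [:: (op c d, false)]) ++ pos_word b).
rewrite -gamma_rel -[X in _ =g X]/([:: (d, false); (d, true)] ++
  [:: (c, false); (d, false)] ++ pos_word b).
by rewrite (gamma_free _ d false).
Qed.

Definition comm_word (cs : seq (word T * word T)) : word T :=
  flatten [seq word_comm c.1 c.2 | c <- cs].

(** Equality in the abelianization, with the product of commutators as explicit witness. *)
Definition gamma_ab_eq (s t : word T) : Prop :=
  exists cs, s =g comm_word cs ++ t.

Lemma gamma_ab_refl s : gamma_ab_eq s s.
Proof. by exists [::]; apply: gamma_refl. Qed.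

Lemma gamma_ab_trans s t u :
  gamma_ab_eq s t -> gamma_ab_eq t u -> gamma_ab_eq s u.
Proof.
move=> [c1 e1] [c2 e2]; exists (c1 ++ c2).
by rewrite /comm_word map_cat flatten_cat -catA e1 e2.
Qed.

Lemma gamma_ab_cat s1 s2 t1 t2 :
  gamma_ab_eq s1 t1 -> gamma_ab_eq s2 t2 -> gamma_ab_eq (s1 ++ s2) (t1 ++ t2).
Proof.
move=> [c1 e1] [c2 e2].
(* With $[a,b]=a^{-1}b^{-1}ab$, moving $c_2$ past $t_1$ costs one commutator: $t_1c_2 =
   c_2[c_2,t_1^{-1}]t_1$. *)
exists (c1 ++ c2 ++ [:: (comm_word c2, word_inv t1)]).
rewrite /comm_word !map_cat !flatten_cat /= cats0 -!/(comm_word _) e1 e2.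
rewrite /word_comm word_invK -!catA.
rewrite (catA (comm_word c2)) gamma_mulV /= (catA (word_inv t1)) gamma_Vmul.
by [].
Qed.

Lemma gamma_ab_catC s t : gamma_ab_eq (s ++ t) (t ++ s).
Proof.
exists [:: (word_inv s, word_inv t)].
rewrite /comm_word /= cats0 /word_comm !word_invK -!catA.
by rewrite (catA (word_inv t)) gamma_Vmul /= gamma_Vmul cats0.
Qed.

Lemma gamma_ab_op x y :
  gamma_ab_eq [:: (op x y, false)] [:: (x, false)].
Proof.
(* $x^y = y^{-1}xy = [y,x^{-1}]\,x$. *)
exists [:: ([:: (y, false)], [:: (x, true)])].
rewrite /comm_word /= -gamma_rel.
rewrite -[X in _ =g X]/([:: (y, true); (x, false); (y, false)] ++
  [:: (x, true); (x, false)]).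
by rewrite (gamma_free op x true) cats0.
Qed.

Lemma gamma_ab_op_sym x y :
  gamma_ab_eq [:: (x, false)] [:: (op x y, false)].
Proof.
(* $x = [x^{-1},y]\,x^y$. *)
exists [:: ([:: (x, true)], [:: (y, false)])].
rewrite /comm_word /= -[X in _ =g X]/([:: (x, false); (y, true); (x, true);
  (y, false)] ++ [:: (op x y, false)]) -gamma_rel.
rewrite -[X in _ =g X]/([:: (x, false); (y, true); (x, true)] ++
  [:: (y, false); (y, true)] ++ [:: (x, false); (y, false)]).
rewrite (gamma_free op y false) /=.
rewrite -[X in _ =g X]/([:: (x, false); (y, true)] ++
  [:: (x, true); (x, false)] ++ [:: (y, false)]).
rewrite (gamma_free op x true) /=.
rewrite -[X in _ =g X]/([:: (x, false)] ++ [:: (y, true); (y, false)]).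
by rewrite (gamma_free op y true) cats0.
Qed.

Lemma in_comm_sub_of_gamma_ab s t :
  gamma_ab_eq s t -> in_comm_sub op (s ++ word_inv t).
Proof. by move=> [cs e]; exists cs; rewrite e gamma_mulK. Qed.

End Gamma.

(** * The monoid of braid orbits *)

Section BraidMonoid.

Variables (T : finType) (op : T -> T -> T).
Hypothesis rackT : is_rack op.

Notation "s =b t" := (braid_equiv op s t) (at level 70).
Notation conn := (rack_conn op).

Lemma braid_refl s : s =b s. Proof. exact: rst_refl. Qed.

#[local] Hint Resolve braid_refl : core.

#[local] Instance braid_equivalence : Equivalence (braid_equiv op).
Proof.
by split; [exact: rst_refl | exact: rst_sym | exact: rst_trans].
Qed.

#[local] Instance braid_cat_proper :
  Proper (braid_equiv op ==> braid_equiv op ==> braid_equiv op) (@cat T).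
Proof.
move=> s1 t1 eq1 s2 t2 eq2; apply: (@rst_trans _ _ _ (t1 ++ s2)).
  elim: eq1 => [_ _ [a [b [c [d [-> ->]]]]] | s | s t _ | s t u _ IH1 _ IH2].
  - apply: rst_step; exists a, (b ++ s2), c, d.
    by rewrite -!catA.
  - exact: rst_refl.
  - exact: rst_sym.
  - exact: rst_trans IH1 IH2.
elim: eq2 => [_ _ [a [b [c [d [-> ->]]]]] | s | s t _ | s t u _ IH1 _ IH2].
- by apply: rst_step; exists (t1 ++ a), b, c, d; rewrite -!catA.
- exact: rst_refl.
- exact: rst_sym.
- exact: rst_trans IH1 IH2.
Qed.

Lemma braid_size s t : s =b t -> size s = size t.
Proof.
by elim=> {s t} [_ _ [a [b [c [d [-> ->]]]]] | s | s t _ | s t u _ -> _] //;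
  rewrite !size_cat.
Qed.

Lemma braid_catl s t1 t2 : t1 =b t2 -> s ++ t1 =b s ++ t2.
Proof. by move=> ->. Qed.

Lemma braid_swap c d s : c :: d :: s =b d :: op c d :: s.
Proof. by apply: rst_step; exists [::], s, c, d. Qed.

Lemma braid_cons x s t : s =b t -> x :: s =b x :: t.
Proof. exact: (@braid_catl [:: x]). Qed.

(** * Central powers *)

Lemma braid_cons_nseq x z k :
  x :: nseq k z =b nseq k z ++ [:: iter k (op^~ z) x].
Proof.
elim: k x => // k IHk x; rewrite iterSr.
by apply: rst_trans (braid_swap _ _ _) (braid_cons _ (IHk _)).
Qed.

Lemma braid_nseq_rcons z x k :
  nseq k z ++ [:: x] =b x :: nseq k (op z x).
Proof.
elim: k => [|k IHk] //=; rewrite (braid_cons z IHk); exact: braid_swap.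
Qed.

(** The exponent $m$: a common multiple of all cycle lengths of the permutations $x\mapsto x^y$. *)
Definition rack_exp := #|T|`!.

Lemma rack_exp_gt0 : 0 < rack_exp. Proof. exact: fact_gt0. Qed.

Lemma op_inj y : injective (op^~ y).
Proof. by case: rackT => /(_ y) /bij_inj. Qed.

Lemma iter_rack_exp y x : iter rack_exp (op^~ y) x = x.
Proof.
have /dvdnP[q ->] : order (op^~ y) x %| rack_exp.
  by apply: dvdn_fact; rewrite order_gt0 max_card.
elim: q => //= q IHq; rewrite mulSn addnC iterD iter_order //; exact: op_inj.
Qed.

Definition power_word (l : seq T) : seq T := flatten [seq nseq rack_exp z | z <- l].

Lemma power_word_cons z l : power_word (z :: l) = nseq rack_exp z ++ power_word l.
Proof. by []. Qed.

Lemma power_wordD l1 l2 : power_word (l1 ++ l2) = power_word l1 ++ power_word l2.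
Proof. by rewrite /power_word map_cat flatten_cat. Qed.

(* [z^m] is central since [x z^m = z^m x^(z^m)] and [z^m] acts trivially. *)
Lemma nseq_central s z : s ++ nseq rack_exp z =b nseq rack_exp z ++ s.
Proof.
elim: s => [|x s IHs] /=; first by rewrite cats0.
rewrite (braid_cons x IHs) -cat_cons braid_cons_nseq iter_rack_exp.
by rewrite -catA.
Qed.

Lemma power_word_central s l : s ++ power_word l =b power_word l ++ s.
Proof.
elim: l => [|z l IHl]; first by rewrite cats0.
by rewrite power_word_cons -catA -IHl !catA nseq_central.
Qed.

Lemma power_word_rem x l :
  x \in l -> power_word l =b nseq rack_exp x ++ power_word (rem x l).
Proof.
elim: l => // y l IHl; rewrite inE /=; case: eqVneq => [-> //|_ /= xl].
by rewrite !power_word_cons (IHl xl) !catA nseq_central.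
Qed.

(** * Components and their entry counts *)

Lemma rack_conn_sym : symmetric conn.
Proof.
by apply: sym_connect_sym => x y /=; apply: eq_existsb => u; rewrite orbC.
Qed.

Lemma braid_count_conn z s t :
  s =b t -> count (conn^~ z) s = count (conn^~ z) t.
Proof.
elim=> {s t} [_ _ [a [b [c [d [-> ->]]]]] | s | s t _ | s t u _ -> _] //.
rewrite !count_cat /= [(conn c z : nat) + _]addnCA; congr (_ + (_ + (_ + _))).
congr nat_of_bool; apply: (same_connect1 rack_conn_sym).
by apply/existsP; exists d; rewrite eqxx.
Qed.

Lemma gamma_ab_conn x y :
  conn x y -> gamma_ab_eq op [:: (x, false)] [:: (y, false)].
Proof.
case/connectP => p; elim: p x => [|z p IHp] x /=.
  by move=> _ ->; apply: gamma_ab_refl.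
case/andP => /existsP[u /orP[] /eqP eq_xz] pathp lastp.
  apply: gamma_ab_trans (IHp _ pathp lastp).
  by rewrite eq_xz; apply: gamma_ab_op_sym.
apply: gamma_ab_trans (IHp _ pathp lastp).
by rewrite eq_xz; apply: gamma_ab_op.
Qed.

(** Modulo commutators, letters commute and depend only on their component. So the first letter of
    [v] cancels against a letter of [w] in the same component. *)
Lemma gamma_ab_of_counts v w :
  (forall z, count (conn^~ z) v = count (conn^~ z) w) ->
  gamma_ab_eq op (pos_word v) (pos_word w).
Proof.
elim: v w => [|x v IHv] w eq_vw.
  case: w eq_vw => [|a w] eq_vw; first exact: gamma_ab_refl.
  by have := eq_vw a; rewrite /= /rack_conn connect0.
have : has (conn^~ x) w by rewrite has_count -eq_vw /= /rack_conn connect0.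
case/hasP => y yw conn_yx; case/splitPr: w / yw eq_vw => a b eq_vw.
apply: (@gamma_ab_trans _ _ _ ([:: (y, false)] ++ pos_word (a ++ b))).
  apply: (@gamma_ab_cat _ _ [:: (x, false)]).
    by apply: gamma_ab_conn; rewrite rack_conn_sym.
  apply: IHv => z; have := eq_vw z; rewrite !count_cat /=.
  have -> : conn y z = conn x z.
    exact: (same_connect rack_conn_sym conn_yx).
  by lia.
rewrite /pos_word !map_cat /= -!/(pos_word _).
rewrite -[_ :: pos_word b]cat1s -[X in gamma_ab_eq _ X _]cat1s !catA.
by apply: gamma_ab_cat (gamma_ab_catC _ _ _) (gamma_ab_refl _ _).
Qed.

(** * Generating words *)

Lemma generates_sub s t :
  {subset s <= t} -> generates op s -> generates op t.
Proof.
move=> sub_st gen_s S closedS /allP allS; apply: gen_s => //.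
by apply/allP => x /sub_st /allS.
Qed.

Lemma braid_all_closed (S : {set T}) s t :
  (forall a b, a \in S -> b \in S -> op a b \in S) ->
  s =b t -> all (fun e => e \in S) s = all (fun e => e \in S) t.
Proof.
move=> closedS.
elim=> {s t} [_ _ [a [b [c [d [-> ->]]]]] | s | s t _ | s t u _ -> _] //.
rewrite !all_cat /=; congr (_ && _); rewrite !andbA; congr (_ && _).
rewrite andbC; case dS: (d \in S) => //=.
have iterS k x : x \in S -> iter k (op^~ d) x \in S.
  by move=> xS; elim: k => //= k IHk; apply: closedS.
apply/idP/idP => [cS|opS]; first exact: closedS.
(* Closed sets are stable under inverse actions too: $c$ is $c^d$ acted on $m-1$ more times by
   $d$. *)
rewrite -(iter_rack_exp d c) -(prednK rack_exp_gt0) iterSr; exact: iterS.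
Qed.

Lemma braid_generates s t : s =b t -> generates op s -> generates op t.
Proof.
move=> eq_st gen_s S closedS; rewrite -(braid_all_closed closedS eq_st).
exact: gen_s.
Qed.

(* [x z^m = z^m x = x (z^x)^m]. *)
Lemma mem_nseq_op x u z :
  x \in u -> u ++ nseq rack_exp z =b u ++ nseq rack_exp (op z x).
Proof.
case/splitPr => a b; rewrite -!catA /=.
rewrite -![x :: b ++ _]/([:: x] ++ b ++ _) !(nseq_central b).
rewrite !(catA [:: x]) (nseq_central [:: x] z).
by rewrite braid_nseq_rcons.
Qed.

(** The [y] that work for all [z] form a closed set containing the letters of [u], hence
    everything. *)
Lemma generates_nseq_op u z y :
  generates op u -> u ++ nseq rack_exp z =b u ++ nseq rack_exp (op z y).
Proof.
move=> gen_u.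
have [S SP] := finset_of_Prop (fun y => forall z,
  u ++ nseq rack_exp z =b u ++ nseq rack_exp (op z y)).
suff S_T : S = setT by have := in_setT y; rewrite -S_T => /SP; apply.
apply: gen_u => [a b /SP Sa /SP Sb|].
  apply/SP => w; have [opb_bij selfdist] := rackT.
  (* Put $w = t^b$ with $t$ = [g w]; then $w^{a^b} = (t^a)^b$, so the exchanges for [a] and [b]
     suffice. *)
  have [g _ gK] := opb_bij b; rewrite -(gK w) /= -selfdist.
  by rewrite -Sb -Sb Sa.
by apply/allP => x xu; apply/SP => w; apply: mem_nseq_op.
Qed.

Lemma generates_nseq_conn u z1 z2 :
  generates op u -> conn z1 z2 ->
  u ++ nseq rack_exp z1 =b u ++ nseq rack_exp z2.
Proof.
move=> gen_u /connectP[p]; elim: p z1 => [|z p IHp] x /=; first by move=> _ ->.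
case/andP => /existsP[y /orP[] /eqP eq_xz] pathp lastp.
  by rewrite -(IHp z) // eq_xz -generates_nseq_op.
by rewrite -(IHp z) // eq_xz -generates_nseq_op.
Qed.

(** Letters other than [z] are carried rightwards through the copies of [z], which stay
    unchanged. *)
Lemma braid_nseq_left k z s :
  k <= count_mem z s -> exists u, s =b nseq k z ++ u.
Proof.
elim: s k => [|x s IHs] k /=; first by rewrite leqn0 => /eqP->; exists [::].
case: eqVneq => [->|_]; last first.
  case/IHs => u eq_su; exists (iter k (op^~ z) x :: u).
  by rewrite (braid_cons x eq_su) -cat_cons braid_cons_nseq -catA.
case: k => [_|k]; first by exists (z :: s).
by rewrite ltnS => /IHs[u eq_su]; exists u; apply: braid_cons.
Qed.

(** Pigeonhole threshold: with this many entries in one component, some letter occurs more than $m$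
    times. *)
Definition stable_bound := #|T| * rack_exp + 1.

Lemma extract_power z v :
  generates op v -> stable_bound <= count (conn^~ z) v ->
  exists2 u, generates op u & v =b u ++ nseq rack_exp z.
Proof.
move=> gen_v many_z.
have [y conn_yz many_y] : exists2 y, conn y z & rack_exp < count_mem y v.
  apply/exists_inP; apply: contraLR many_z => /exists_inPn few.
  rewrite -ltnNge /stable_bound addn1 ltnS count_sum_count_mem.
  rewrite -sum_nat_const big_mkcond /=; apply: leq_sum => x _.
  by case: ifP => // /few; rewrite -leqNgt.
have [u eq_vu] := braid_nseq_left many_y.
(* Of the $m+1$ copies of [y], one is kept so that the remaining word still generates. *)
have eq_v : v =b (y :: u) ++ nseq rack_exp y.
  by rewrite eq_vu nseq_central -addn1 nseqD -catA.
have gen_yu : generates op (y :: u).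
  apply: generates_sub (braid_generates eq_v gen_v) => x.
  rewrite mem_cat => /orP[//|/nseqP[-> _]]; exact: mem_head.
exists (y :: u) => //.
by rewrite eq_v; apply: generates_nseq_conn.
Qed.

(** * Powers of $D$ and the clearing of inverses *)

Definition full_power k := power_word (flatten (nseq k (enum T))).

Lemma full_powerD j k : full_power (j + k) = full_power j ++ full_power k.
Proof. by rewrite /full_power nseqD flatten_cat power_wordD. Qed.

Lemma full_power_central s k : s ++ full_power k =b full_power k ++ s.
Proof. exact: power_word_central. Qed.

(** Plays the role of $x^{-1}D$. *)
Definition cofactor x :=
  nseq rack_exp.-1 x ++ power_word (rem x (enum T)).

Lemma mul_cofactor x : x :: cofactor x =b full_power 1.
Proof.
rewrite /full_power /= cats0 (power_word_rem (mem_enum _ x)) /cofactor.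
by rewrite -{2}(prednK rack_exp_gt0).
Qed.

Lemma cofactor_mul x : cofactor x ++ [:: x] =b full_power 1.
Proof.
rewrite /full_power /= cats0 (power_word_rem (mem_enum _ x)) /cofactor.
rewrite -catA -power_word_central catA -[[:: x]]/(nseq 1 x) -nseqD addn1 prednK //.
exact: rack_exp_gt0.
Qed.

(* Replacing [x^-1] by [cofactor x] multiplies by one central factor
   [full_power 1] per inverse letter. *)
Definition clear_inverses (w : word T) : seq T :=
  flatten [seq if p.2 then cofactor p.1 else [:: p.1] | p <- w].

Lemma clear_inverses_cat w1 w2 :
  clear_inverses (w1 ++ w2) = clear_inverses w1 ++ clear_inverses w2.
Proof. by rewrite /clear_inverses map_cat flatten_cat. Qed.

Lemma clear_inverses_pos s : clear_inverses (pos_word s) = s.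
Proof. by elim: s => //= x s {2}<-. Qed.

Lemma full_power_mono s t j k : j <= k ->
  s ++ full_power j =b t ++ full_power j -> s ++ full_power k =b t ++ full_power k.
Proof. by move=> /subnKC<- eq_st; rewrite !full_powerD !catA eq_st. Qed.

(** Cross-multiplication of fractions: [clear_inverses w] stands for $wD^i$ with $i$ the number of
    inverse letters of $w$. The slack [k] makes the relation transitive. *)
Lemma gamma_eq_clear_inverses w w' :
  gamma_eq op w w' -> exists k,
    clear_inverses w ++ full_power (count snd w' + k) =b
    clear_inverses w' ++ full_power (count snd w + k).
Proof.
elim=> {w w'} [w | w w' _ [k IH]
  | w w' w'' _ [k1 IH1] _ [k2 IH2]
  | w1 w2 w1' w2' _ [k1 IH1] _ [k2 IH2] | x b | x y].
- by exists 0.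
- by exists k; rewrite IH.
(* The slack absorbs the denominator of the intermediate word [w']. *)
- exists (count snd w' + k1 + k2).
  have -> : count snd w'' + (count snd w' + k1 + k2) =
    (count snd w' + k1) + (count snd w'' + k2) by lia.
  have -> : count snd w + (count snd w' + k1 + k2) =
    (count snd w' + k2) + (count snd w + k1) by lia.
  rewrite !(full_powerD (_ + _) (_ + _)) !catA IH1 -IH2.
  by rewrite -!catA -!full_powerD addnC.
- exists (k1 + k2); rewrite !count_cat !clear_inverses_cat.
  rewrite !(addnACA _ _ k1 k2) !(full_powerD (_ + _) (_ + _)) -!catA.
  rewrite (catA (clear_inverses w2)) (full_power_central (clear_inverses w2)).
  rewrite (catA (clear_inverses w2')) (full_power_central (clear_inverses w2')).
  by rewrite -!catA IH2 !catA IH1.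
- exists 0; case: b; rewrite /clear_inverses /= !cats0.
    exact: cofactor_mul.
  exact: mul_cofactor.
(* The rack relation becomes [cofactor y] followed by $xy = y\,x^y$, that is $D\,x^y$. *)
exists 0; rewrite /clear_inverses /= cats0.
rewrite (braid_catl _ (braid_swap x y [::])).
rewrite -[[:: y; _]]/([:: y] ++ [:: op x y]) catA cofactor_mul.
by rewrite -full_power_central.
Qed.

Lemma gamma_eq_pos_braid u v :
  gamma_eq op (pos_word u) (pos_word v) ->
  exists k, u ++ full_power k =b v ++ full_power k.
Proof.
have no_inv s : count snd (pos_word s) = 0 by elim: s.
by case/gamma_eq_clear_inverses => k; rewrite !clear_inverses_pos !no_inv; exists k.
Qed.

(** * A uniform exponent, and large words *)

Lemma bounded_gamma_eq_braid B : exists K, forall u v,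
  size u <= B -> size v <= B -> gamma_eq op (pos_word u) (pos_word v) ->
  u ++ full_power K =b v ++ full_power K.
Proof.
have [||K KP] := @bounded_seq_uniform_bound T B (fun u k => forall v,
  size v <= B -> gamma_eq op (pos_word u) (pos_word v) ->
  u ++ full_power k =b v ++ full_power k).
- by move=> u j k le_jk IH v le_v eq_uv; apply: full_power_mono le_jk (IH v _ _).
- move=> u; apply: bounded_seq_uniform_bound => [v j k le_jk IH eq_uv|v].
    exact: full_power_mono le_jk (IH eq_uv).
  (* Pairs that differ in [Gamma_T] satisfy the claim vacuously, with exponent 0. *)
  have [eq_uv|neq_uv] := classic (gamma_eq op (pos_word u) (pos_word v)).
    by have [k] := gamma_eq_pos_braid eq_uv; exists k.
  by exists 0 => /neq_uv.
by exists K => u v le_u le_v; apply: KP.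
Qed.

Lemma size_le_counts B s :
  (forall z, count (conn^~ z) s <= B) -> size s <= #|T| * B.
Proof.
move=> le_sB; rewrite -count_predT count_sum_count_mem -sum_nat_const.
apply: leq_sum => x _; apply: leq_trans (le_sB x).
by apply: sub_count => y /eqP->; apply: connect0.
Qed.

Lemma gamma_eq_braid_cancel u v s :
  gamma_eq op (pos_word (u ++ s)) (pos_word (v ++ s)) ->
  gamma_eq op (pos_word u) (pos_word v).
Proof. by rewrite /pos_word !map_cat => /gamma_cancel_right. Qed.

(* Stripping a common central power [z^m] from both words as long as some
   component is over-represented leaves finitely many pairs. *)
Lemma stable_gamma_eq_braid : exists K, forall v w,
  generates op v -> generates op w ->
  (forall z, stable_bound <= count (conn^~ z) v) ->
  (forall z, count (conn^~ z) v = count (conn^~ z) w) ->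
  gamma_eq op (pos_word v) (pos_word w) ->
  v ++ full_power K =b w ++ full_power K.
Proof.
have [K KP] := bounded_gamma_eq_braid (#|T| * (stable_bound + rack_exp)).
exists K => v; have [n] := ubnP (size v).
elim: n v => // n IHn v ltvn w gen_v gen_w many eq_vw eq_g.
have [/existsP[z big_z]|/existsPn small] :=
    boolP [exists z, stable_bound + rack_exp <= count (conn^~ z) v].
  have [u gen_u eq_vu] := extract_power gen_v (many z).
  have many_w : stable_bound <= count (conn^~ z) w by rewrite -eq_vw.
  have [u' gen_u' eq_wu'] := extract_power gen_w many_w.
  have cnt_u y : count (conn^~ y) v = count (conn^~ y) u + conn z y * rack_exp.
    by rewrite (braid_count_conn y eq_vu) count_cat count_nseq.
  have cnt_u' y : count (conn^~ y) w = count (conn^~ y) u' + conn z y * rack_exp.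
    by rewrite (braid_count_conn y eq_wu') count_cat count_nseq.
  have size_v : size v = size u + rack_exp.
    by rewrite (braid_size eq_vu) size_cat size_nseq.
  have IH : u ++ full_power K =b u' ++ full_power K.
    apply: IHn => //.
    - by have := rack_exp_gt0; lia.
    (* Only the component of [z] loses entries, and [big_z] gave it $m$ to spare. *)
    - move=> y; have := many y; rewrite cnt_u; case conn_zy: (conn z y); last by lia.
      move=> _; rewrite -(leq_add2r rack_exp); apply: leq_trans big_z _.
      suff -> : count (conn^~ z) v = count (conn^~ y) v by rewrite cnt_u conn_zy mul1n.
      apply: eq_count => x; rewrite !(rack_conn_sym x).
      exact: (same_connect rack_conn_sym conn_zy).
    - by move=> y; have := eq_vw y; rewrite cnt_u cnt_u' => /addIn.
    apply: (@gamma_eq_braid_cancel _ _ (nseq rack_exp z)).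
    apply: gamma_trans (gamma_sym (gamma_of_braid eq_vu)) _.
    exact: gamma_trans eq_g (gamma_of_braid eq_wu').
  by rewrite eq_vu eq_wu' -!catA !(full_power_central (nseq _ _)) !catA IH.
(* With no over-represented component, both words have bounded length. *)
apply: KP => //; apply: size_le_counts => z; first by have := small z; lia.
by have := small z; rewrite -eq_vw; lia.
Qed.

Lemma extract_power_word l v :
  generates op v ->
  (forall z, stable_bound + rack_exp * size l <= count (conn^~ z) v) ->
  exists2 u, generates op u & v =b u ++ power_word l.
Proof.
elim: l v => [|z l IHl] v gen_v many; first by exists v; rewrite ?cats0.
have [|u gen_u eq_vu] := @extract_power z _ gen_v.
  exact: leq_trans (leq_addr _ _) (many z).
have [|u' gen_u' eq_uu'] := IHl _ gen_u.
  move=> y; have := many y; rewrite (braid_count_conn y eq_vu) count_cat count_nseq /=.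
  by case: (conn z y); rewrite ?mul1n ?mul0n mulnS; lia.
by exists u' => //; rewrite eq_vu eq_uu' power_word_cons -catA power_word_central.
Qed.

(** Both words are split as a generating word times $D^K$; the first factors agree in [Gamma_T] by
    cancellation, so restoring $D^K$ makes the orbits equal. *)
Lemma large_gamma_eq_braid : exists N0, forall v w,
  generates op v -> generates op w ->
  (forall z, N0 <= count (conn^~ z) v) ->
  (forall z, count (conn^~ z) v = count (conn^~ z) w) ->
  gamma_eq op (pos_word v) (pos_word w) -> v =b w.
Proof.
have [K KP] := stable_gamma_eq_braid.
set l := flatten (nseq K (enum T)).
(* Removing $D^K$ takes at most [rack_exp * size l] entries from a component, leaving
   [stable_bound]. *)
exists (stable_bound + rack_exp * size l) => v w gen_v gen_w many eq_vw eq_g.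
have [u gen_u eq_vu] := extract_power_word gen_v many.
have [|u' gen_u' eq_wu'] := @extract_power_word l _ gen_w.
  by move=> z; rewrite -eq_vw.
rewrite eq_vu eq_wu'; apply: KP => //.
- move=> z; have := many z; rewrite (braid_count_conn z eq_vu) count_cat.
  suff : count (conn^~ z) (power_word l) <= rack_exp * size l by lia.
  apply: leq_trans (count_size _ _) _.
  rewrite /power_word; elim: (l) => //= y l' IH.
  by rewrite size_cat size_nseq mulnS leq_add2l.
- move=> z; have := eq_vw z.
  by rewrite (braid_count_conn z eq_vu) (braid_count_conn z eq_wu') !count_cat => /addIn.
apply: (@gamma_eq_braid_cancel _ _ (power_word l)).
apply: gamma_trans (gamma_sym (gamma_of_braid eq_vu)) _.
exact: gamma_trans eq_g (gamma_of_braid eq_wu').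
Qed.

End BraidMonoid.

(** * Product racks and the conclusion *)

Lemma rack_conn_prod (X Y : finType) (opX : X -> X -> X) (opY : Y -> Y -> Y)
    (p q : X * Y) :
  rack_conn (prod_op opX opY) p q ->
  rack_conn opX p.1 q.1 && rack_conn opY p.2 q.2.
Proof.
case/connectP => s; elim: s p => [|r s IHs] p /=.
  by move=> _ ->; rewrite /rack_conn !connect0.
case/andP => /existsP[u step] paths lasts.
have /andP[cX cY] := IHs _ paths lasts.
apply/andP; split.
  apply: connect_trans (connect1 _) cX; apply/existsP; exists u.1.
  by case/orP: step => /eqP->; rewrite /= eqxx ?orbT.
apply: connect_trans (connect1 _) cY; apply/existsP; exists u.2.
by case/orP: step => /eqP->; rewrite /= eqxx ?orbT.
Qed.

Lemma is_rack_prod (X Y : Type) (opX : X -> X -> X) (opY : Y -> Y -> Y) :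
  is_rack opX -> is_rack opY -> is_rack (prod_op opX opY).
Proof.
move=> [bijX distX] [bijY distY]; split=> [[x y]|p q r]; last first.
  by rewrite /prod_op /= distX distY.
have [[g gK Kg] [h hK Kh]] := (bijX x, bijY y).
by exists (fun p => (g p.1, h p.2)) => -[a b]; rewrite /prod_op /= ?gK ?hK ?Kg ?Kh.
Qed.

Theorem theorem4p30 (X Y : finType) (opX : X -> X -> X) (opY : Y -> Y -> Y)
  (rackX : is_rack opX) (rackY : is_rack opY)
  (prodXY : productive opX opY) (syncXY : synchronized opX opY) :
  exists N0 : nat, forall N : nat, N0 <= N ->
    forall v w : seq (X * Y),
      in_Sstar (prod_op opX opY) N v -> in_Sstar (prod_op opX opY) N w ->
      braid_equiv opX (map fst v) (map fst w) ->
      braid_equiv opY (map snd v) (map snd w) ->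
      (forall (x : X) (a : Y),
         count (fun e => rack_conn opX e.1 x && rack_conn opY e.2 a) v =
         count (fun e => rack_conn opX e.1 x && rack_conn opY e.2 a) w) ->
      braid_equiv (prod_op opX opY) v w.
Proof.
have rackXY := is_rack_prod rackX rackY.
have [N0 N0P] := large_gamma_eq_braid rackXY.
exists N0 => N le_N v w [_ [many_v gen_v]] [_ [_ gen_w]] eqX eqY eq_vw.
(* Synchronization identifies components of the product with pairs of components, so (iii) counts
   entries per component. *)
have eq_conn z : (rack_conn (prod_op opX opY))^~ z =1
    (fun e => rack_conn opX e.1 z.1 && rack_conn opY e.2 z.2).
  move=> e; apply/idP/idP => [|/andP[]]; first exact: rack_conn_prod.
  exact: (proj1 syncXY).
have eq_counts z : count ((rack_conn (prod_op opX opY))^~ z) v =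
    count ((rack_conn (prod_op opX opY))^~ z) w.
  by rewrite !(eq_count (eq_conn z)).
apply: N0P => // [z|]; first exact: leq_trans le_N (many_v z).
(* Productivity is applied to $vw^{-1}$ and the empty word, since only elements of the commutator
   subgroup are covered. *)
apply: (@gamma_cancel_right _ _ _ _ (word_inv (pos_word w))).
apply: gamma_trans (gamma_sym (gamma_mulV _ _)).
have proj_trivial (Z : Type) (opZ : Z -> Z -> Z) (f : X * Y -> Z) :
    braid_equiv opZ (map f v) (map f w) ->
    gamma_eq opZ (map_word f (pos_word v ++ word_inv (pos_word w))) [::].
  move=> /gamma_of_braid eq_f; rewrite /map_word map_cat -!/(map_word _ _).
  rewrite map_word_inv !map_word_pos; apply: gamma_trans (gamma_mulV _ _).
  exact: gamma_cat eq_f (gamma_refl _ _).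
apply: prodXY; [|by exists [::]; apply: gamma_refl | exact: proj_trivial..].
exact/in_comm_sub_of_gamma_ab/gamma_ab_of_counts.
Qed.
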